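(* Let $x,y,z$ be real numbers in $[-1,1]$ and let $$A=\begin{pmatrix} 1 & x & y \\ x & 1 & z \\ y & z & 1 \end{pmatrix}.$$ Then $A$ is positive-semidefinite if and only if $|A|=1-x^2-y^2-z^2+2xyz\ge0$.
   Context: $|A|$ denotes the determinant of $A$. *)

(* Defs.v *)
From mathcomp Require Import all_boot all_order all_algebra.
From mathcomp Require Import reals.

Set Implicit Arguments.
Unset Strict Implicit.
Unset Printing Implicit Defensive.

Import Order.TTheory GRing.Theory Num.Theory.
Local Open Scope ring_scope.

(* [v *m A *m v^T] is a 1 x 1 matrix; its entry at [0 0] is the value of the
   quadratic form of A at v. *)
Definition positive_semidefinite (R : realType) (n : nat) (A : 'M[R]_n) : Prop :=
  A^T = A /\ forall v : 'rV[R]_n, 0 <= (v *m A *m v^T) 0 0.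

Definition unit_diag_sym_mx3 (R : realType) (x y z : R) : 'M[R]_3 :=
  \matrix_(i < 3, j < 3)
    nth 0 (nth [::] [:: [:: 1; x; y];
                        [:: x; 1; z];
                        [:: y; z; 1]] i) j.

(* Main.v *)
Require Import Defs.
From mathcomp Require Import all_boot all_order all_algebra.
From mathcomp Require Import reals.
From mathcomp Require Import ring lra.

(** Put p = 1 - x^2, q = 1 - y^2, r = z - x y. Completing the square in the first
    coordinate turns the quadratic form of A into
    (a + b x + c y)^2 + (p b^2 + 2 r b c + q c^2), and |A| = p q - r^2. Since
    a is free to cancel the square, A is positive semidefinite iff the binary
    form is, and as p, q >= 0 this means that r^2 <= p q. *)

Import Order.TTheory GRing.Theory Num.Theory.
Local Open Scope ring_scope.

(** For p > 0, p times the form is (p b + r c)^2 + (p q - r^2) c^2. For p = 0, either side forces r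
    = 0, which leaves q c^2. *)
Lemma binary_form_ge0P (R : realFieldType) (p q r : R) : 0 <= p -> 0 <= q ->
  (forall b c, 0 <= p * b ^+ 2 + 2 * r * b * c + q * c ^+ 2) <->
  0 <= p * q - r ^+ 2.
Proof.
move=> p_ge0 q_ge0; have [p0 | p_neq0] := eqVneq p 0.
  (* With p = 0, the form takes the value -4 r^2 at (-(q + 1), 2 r). *)
  rewrite p0; split=> [/(_ (- (q + 1)) (2 * r)) | disc_ge0 b c]; first by nra.
  have /eqP : r ^+ 2 = 0 by apply/eqP; rewrite eq_le sqr_ge0 andbT; nra.
  by rewrite expf_eq0 /= => /eqP->; nra.
have p_gt0 : 0 < p by rewrite lt_def p_neq0.
(* The point (-r, p) makes p b + r c vanish, so the form equals p (p q - r^2) there. *)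
split=> [/(_ (- r) p) form_ge0 | disc_ge0 b c]; rewrite -(pmulr_rge0 _ p_gt0).
  have -> // : p * (p * q - r ^+ 2) =
               p * (- r) ^+ 2 + 2 * r * (- r) * p + q * p ^+ 2 by ring.
have -> : p * (p * b ^+ 2 + 2 * r * b * c + q * c ^+ 2) =
          (p * b + r * c) ^+ 2 + (p * q - r ^+ 2) * c ^+ 2 by ring.
by apply: addr_ge0; [exact: sqr_ge0 | apply: mulr_ge0 => //; exact: sqr_ge0].
Qed.

Lemma trmx_unit_diag_sym_mx3 (R : realType) (x y z : R) :
  (unit_diag_sym_mx3 x y z)^T = unit_diag_sym_mx3 x y z.
Proof. by apply/matrixP=> -[[|[|[|i]]] Hi] -[[|[|[|j]]] Hj]; rewrite !mxE. Qed.

Lemma det_unit_diag_sym_mx3 (R : realType) (x y z : R) :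
  \det (unit_diag_sym_mx3 x y z) = 1 - x ^+ 2 - y ^+ 2 - z ^+ 2 + 2 * x * y * z.
Proof.
have det2 (M : 'M[R]_2) : \det M = M 0 0 * M 1 1 - M 0 1 * M 1 0.
  rewrite (expand_det_row _ 0) !big_ord_recl big_ord0 /cofactor !det_mx11 !mxE.
  have -> : lift ord0 ord0 = 1 :> 'I_2 by apply: val_inj.
  have -> : lift 1 0 = 0 :> 'I_2 by apply: val_inj.
  by rewrite /= expr0 expr1; ring.
rewrite (expand_det_row _ 0) !big_ord_recl big_ord0 /cofactor !det2 !mxE /=.
by rewrite /bump /=; ring.
Qed.

Lemma form_unit_diag_sym_mx3 (R : realType) (x y z : R) (v : 'rV[R]_3) :
  let a := v 0 0 in let b := v 0 1 in let c := v 0 2%:R in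
  (v *m unit_diag_sym_mx3 x y z *m v^T) 0 0 =
  (a + b * x + c * y) ^+ 2 +
  ((1 - x ^+ 2) * b ^+ 2 + 2 * (z - x * y) * b * c + (1 - y ^+ 2) * c ^+ 2).
Proof.
rewrite /= mxE !big_ord_recl big_ord0 !mxE !big_ord_recl !big_ord0 !mxE /=.
have -> : lift ord0 ord0 = 1 :> 'I_3 by apply: val_inj.
have -> : lift ord0 (lift ord0 ord0) = 2%:R :> 'I_3 by apply: val_inj.
by rewrite /=; ring.
Qed.

Lemma psd_unit_diag_sym_mx3P (R : realType) (x y z : R) :
  positive_semidefinite (unit_diag_sym_mx3 x y z) <->
  forall b c, 0 <= (1 - x ^+ 2) * b ^+ 2 + 2 * (z - x * y) * b * c
                   + (1 - y ^+ 2) * c ^+ 2.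
Proof.
split=> [[_ psd] b c | form_ge0].
  (* This first coordinate makes the completed square zero. *)
  have := psd (\row_j nth 0 [:: - (b * x + c * y); b; c] j).
  by rewrite form_unit_diag_sym_mx3 !mxE /= -addrA addNr expr0n add0r.
split=> [|v]; first exact: trmx_unit_diag_sym_mx3.
by rewrite form_unit_diag_sym_mx3 addr_ge0 ?sqr_ge0.
Qed.

Theorem proposition4p2 (R : realType) (x y z : R)
    (hx : -1 <= x <= 1) (hy : -1 <= y <= 1) (hz : -1 <= z <= 1) :
  let A := unit_diag_sym_mx3 x y z in
  \det A = 1 - x ^+ 2 - y ^+ 2 - z ^+ 2 + 2 * x * y * z /\
  (positive_semidefinite A <-> 0 <= \det A).
Proof.
move=> A; split; first exact: det_unit_diag_sym_mx3.
(* Both factors of (1 - x)(1 + x) are nonnegative; likewise for y. *)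
have p_ge0 : 0 <= 1 - x ^+ 2 by nra.
have q_ge0 : 0 <= 1 - y ^+ 2 by nra.
(* The right side is the determinant of the Schur complement of the top-left entry 1. *)
have -> : \det A = (1 - x ^+ 2) * (1 - y ^+ 2) - (z - x * y) ^+ 2.
  by rewrite det_unit_diag_sym_mx3; ring.
apply: iff_trans (psd_unit_diag_sym_mx3P R x y z) _.
exact: binary_form_ge0P.
Qed.
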